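(* (i) The functions $x^{\rho}$, for $\rho\in\mathbb{C}$ with $\operatorname{Re}(\rho)>-1$, are all eigenfunctions of the operator $P$ in $\mathcal{F}$, with eigenvalue $\frac{1}{\rho+1}$. Each spans a one-dimensional eigenspace of $P$. (ii) For each eigenvalue $\frac{1}{\rho+1}$ (with $\rho\in\mathbb{C}$, $\operatorname{Re}(\rho)>-1$), the corresponding generalised eigenfunctions of $P$ are the functions $x^{\rho}(\ln x)^{m}$, $m=1,2,3,\ldots$; here $x^{\rho}(\ln x)^{m}$ is a generalised eigenfunction of order $m$ with eigenvalue $\frac{1}{\rho+1}$.
   Context: $\mathcal{F}$ is the space of complex-valued functions $f$ on $[0,\infty)$ such that $\int_{0}^{x}|f(t)(\ln t)^{m}|\,dt<\infty$ for all $x\geq 1$ and all integers $m\geq 0$ (values at the single point $0$ are irrelevant; functions are considered for $x>0$). The continuous Cesàro operator $P:\mathcal{F}\to\mathcal{F}$ is $$P[f](x)=\frac{1}{x}\int_{0}^{x}f(t)\,dt .$$ An eigenfunction of $P$ with eigenvalue $\lambda$ is a nonzero $f\in\mathcal{F}$ with $P[f]=\lambda f$. For an integer $m\ge 1$, a generalised eigenfunction of order $m$ with eigenvalue $\lambda$ is an $f\in\mathcal{F}$ with $(P-\lambda)^{m+1}[f]=0$ and $(P-\lambda)^{m}[f]\neq 0$. For $x>0$, $x^{\rho}=e^{\rho\ln x}$. *)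

(* Defs.v *)
From HB Require Import structures.
From mathcomp Require Import all_boot all_order all_algebra.
From mathcomp Require Import all_classical all_reals all_analysis.
From mathcomp Require Import complex.

Set Implicit Arguments.
Unset Strict Implicit.
Unset Printing Implicit Defensive.

Import Order.TTheory GRing.Theory Num.Theory.
Import numFieldNormedType.Exports.

Local Open Scope classical_set_scope.
Local Open Scope ring_scope.
Local Open Scope complex_scope.

(* Functions on (0, oo) are represented by total functions R -> R[i] whose
   values on (-oo, 0] are never inspected: every integral is taken over ]0, x]
   and every (in)equality of functions is tested on x > 0 only.  Integrals are
   Lebesgue integrals. *)

Section Cesaro.
Variable R : realType.
Implicit Types (f g : R -> R[i]) (lam rho z : R[i]) (m : nat) (x t : R).

Definition eq_pos f g : Prop := forall x, 0 < x -> f x = g x.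

Definition zero_fun : R -> R[i] := fun=> 0.

(* Measurability, implicit in writing the integrals, is that of the real and
   imaginary parts. *)
Definition inF f : Prop :=
  [/\ measurable_fun (`]0, +oo[ : set R) (fun t => complex.Re (f t)),
      measurable_fun (`]0, +oo[ : set R) (fun t => complex.Im (f t))
    & forall x m, 1 <= x ->
      (\int[lebesgue_measure]_(t in `]0%R, x])
         (Normc.normc (f t * (ln t ^+ m)%:C)%R)%:E < +oo)%E].

Definition integralC (D : set R) f : R[i] :=
  (\int[lebesgue_measure]_(t in D) complex.Re (f t))
  +i* (\int[lebesgue_measure]_(t in D) complex.Im (f t)).

Definition cesaro f : R -> R[i] :=
  fun x => (x%:C)^-1 * integralC `]0, x] f.

Definition cesaro_sub lam f : R -> R[i] :=
  fun x => cesaro f x - lam * f x.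

Definition in_eigenspace lam f : Prop :=
  inF f /\ eq_pos (cesaro f) (fun x => lam * f x).

Definition eigenfunction lam f : Prop :=
  in_eigenspace lam f /\ ~ eq_pos f zero_fun.

Definition gen_eigenfunction m lam f : Prop :=
  [/\ inF f,
      eq_pos (iter m.+1 (cesaro_sub lam) f) zero_fun
    & ~ eq_pos (iter m (cesaro_sub lam) f) zero_fun].

Definition expC z : R[i] :=
  (expR (complex.Re z) * cos (complex.Im z))
  +i* (expR (complex.Re z) * sin (complex.Im z)).

Definition cpow rho : R -> R[i] := fun x => expC (rho * (ln x)%:C).

Definition cpow_ln rho m : R -> R[i] :=
  fun x => cpow rho x * (ln x ^+ m)%:C.

End Cesaro.

(* Main.v *)
Require Import Defs.
From HB Require Import structures.
From mathcomp Require Import all_boot all_order all_algebra.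
From mathcomp Require Import all_classical all_reals all_analysis.
From mathcomp Require Import complex.
From mathcomp Require Import measurable_realfun ring lra.

(** Write mu = rho + 1, and for a polynomial q let powlog rho q be the function
x^rho q(ln x); the span of the x^rho (ln x)^j with j <= m consists of the
powlog rho q with deg q <= m. Since (x^mu p(ln x))' = x^rho (mu p + p')(ln x)
and Re mu > 0 makes x^mu p(ln x) vanish at 0,

  P (powlog rho (mu p + p')) = powlog rho p            ([cesaro_powlog]),

hence (P - 1/mu) (powlog rho (mu p + p')) = powlog rho (- p' / mu)
([cesaro_sub_powlog]). The operator p |-> mu p + p' is a degree preserving
bijection of polynomials ([shift_deriv_surj]), so P - 1/mu lowers the degree of
q by exactly one and kills constants ([cesaro_sub_powlog_size]): if deg q = m
then (P - 1/mu)^m turns powlog rho q into a nonzero multiple of x^rho, and one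
more application kills it.

Conversely, if P f = f / mu then Phi(x) = \int_0^x f satisfies x Phi' = mu Phi, so
Phi is a multiple of x^mu and f one of x^rho ([eigenspace_cpow]). If
(P - 1/mu)^(m+1) f = 0, then by induction (P - 1/mu) f = powlog rho q for some q
of degree < m; an antiderivative of - mu q provides r with deg r <= m and
(P - 1/mu) (powlog rho r) = powlog rho q, so f - powlog rho r is an
eigenfunction ([powlog_of_iter_eq0]).

The induction needs P to map the space F into itself, which is where the
weights (ln t)^m in the definition of F enter: by Tonelli,
\int_0^x |P f(t)| |ln t|^m dt is at most the integral of |f(s)| times
\int_s^x |ln t|^m dt / t, which is at most (|ln s| + |ln x|)^(m+1)
([logL1_cesaro]).

All differential equations are solved in the variable u = ln x, which runs over
the whole line: there x^rho becomes e^(rho u), and a function with zero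
derivative is constant without any boundary discussion. *)

Set Implicit Arguments.
Unset Strict Implicit.
Unset Printing Implicit Defensive.

Import Order.TTheory GRing.Theory Num.Theory.
Import numFieldNormedType.Exports.

Local Open Scope ring_scope.
Local Open Scope complex_scope.

(** * The operator p |-> a p + p' on polynomials *)

Lemma size_shift_deriv (F : fieldType) (a : F) (p : {poly F}) : a != 0 ->
  size (a *: p + p^`()) = size p.
Proof.
move=> a0; have [->|p0] := eqVneq p 0; first by rewrite scaler0 deriv0 addr0.
by rewrite size_polyDl size_scale// lt_size_deriv.
Qed.

(** The inverse of a + d/dX is the finite Neumann series
sum_k (-1)^k a^-(k+1) (d/dX)^k; the induction on the degree unrolls it. *)
Lemma shift_deriv_surj (F : fieldType) (a : F) (q : {poly F}) : a != 0 ->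
  exists2 p, a *: p + p^`() = q & size p = size q.
Proof.
move=> a0; suff [p pE] : exists p, a *: p + p^`() = q.
  by exists p => //; rewrite -pE size_shift_deriv.
have [n] := ubnP (size q); elim: n q => // n IH q; rewrite ltnS => qn.
have [->|q0] := eqVneq q 0; first by exists 0; rewrite scaler0 deriv0 addr0.
have [p pE] := IH q^`() (leq_trans (lt_size_deriv q0) qn).
exists (a^-1 *: (q - p)).
rewrite derivZ derivB scalerA mulfV// scale1r.
by rewrite -pE addrK scalerA mulVf// scale1r subrK.
Qed.

Lemma poly_antideriv (F : numFieldType) (q : {poly F}) :
  exists2 s, s^`() = q & (size s <= (size q).+1)%N.
Proof.
exists (\poly_(i < (size q).+1) (q`_i.-1 / i%:R)); last exact: size_poly.
apply/polyP => i; rewrite coef_deriv coef_poly ltnS /=.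
have [iq|qi] := ltnP i (size q).
  by rewrite -[LHS]mulr_natr mulfVK// pnatr_eq0.
by rewrite mul0rn nth_default.
Qed.

Lemma size_deriv_num (F : numFieldType) (p : {poly F}) : size p^`() = (size p).-1.
Proof.
have [p1|p1] := leqP (size p) 1.
  by rewrite (size1_polyC p1) derivC size_poly0 size_polyC; case: eqP.
apply/eqP; rewrite eqn_leq; apply/andP; split.
  by rewrite -ltnS prednK ?lt_size_deriv -?size_poly_gt0// (ltn_trans _ p1).
case E : (size p) p1 => [|[|n]]// _ /=; rewrite ltnNge; apply/negP => h.
have := nth_default 0 h; rewrite coef_deriv => /eqP.
rewrite mulrn_eq0/= -[n.+1]/(n.+2.-1) -E -lead_coefE.
by rewrite lead_coef_eq0 -size_poly_eq0 E.
Qed.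

Section CesaroEigenfunctions.
Local Open Scope classical_set_scope.
Local Open Scope ring_scope.
Local Open Scope complex_scope.
Variable R : realType.
Implicit Types (f g : R -> R) (m n : nat) (x t u : R).
Local Notation mu := (@lebesgue_measure R).

(** * Real functions integrable against all powers of the logarithm *)

(** The real counterpart of [inF]: a complex function is in F exactly when its
real and imaginary parts satisfy [logL1] (see [inF_logL1]), so all measure
theory can be done with real functions. *)
Definition logL1 g : Prop :=
  measurable_fun (`]0, +oo[ : set R) g /\
  forall x m, 0 < x ->
    mu.-integrable `]0, x] (EFin \o (fun t => g t * ln t ^+ m)).

Lemma subset_oc_ray x : (`]0, x] : set R) `<=` `]0, +oo[.
Proof. by move=> t /=; rewrite !in_itv/= => /andP[->]. Qed.

Lemma logL1_integrable g x :
  logL1 g -> 0 < x -> mu.-integrable `]0, x] (EFin \o g).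
Proof.
move=> [_ ig] x0; apply: eq_integrable (ig x 0%N x0) => // t _.
by rewrite /= expr0 mulr1.
Qed.

Lemma logL1_le g f C :
  measurable_fun (`]0, +oo[ : set R) f ->
  (forall t, 0 < t -> `|f t| <= C * `|g t|) -> logL1 g -> logL1 f.
Proof.
move=> mf fg [mg ig]; split => // x m x0.
apply: (@le_integrable _ _ _ mu _ _ _
  (fun t => C%:E * (g t * ln t ^+ m)%:E)%E) => //.
- apply/measurable_EFinP; apply: measurable_funM.
    exact: measurable_funS (@subset_oc_ray x) mf.
  apply: measurable_funX; exact: measurable_funS (@measurable_ln R).
- move=> t /=; rewrite in_itv/= => /andP[t0 _].
  rewrite lee_fin !normrM mulrA ler_wpM2r//.
  by rewrite (le_trans (fg t t0))// ler_wpM2r// ler_norm.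
- exact: integrableZl (ig x m x0).
Qed.

Lemma logL1_ext f g : (forall t, 0 < t -> f t = g t) -> logL1 f -> logL1 g.
Proof.
move=> fg Lf; apply: (logL1_le (g := f) (C := 1)) => //.
  by apply: eq_measurable_fun Lf.1 => t; rewrite inE/= in_itv/= andbT; exact: fg.
by move=> t t0; rewrite mul1r fg.
Qed.

Lemma logL1_lin f g a b : logL1 f -> logL1 g ->
  logL1 (fun t => a * f t + b * g t).
Proof.
move=> [mf fi] [mg gi]; split.
  by apply: measurable_funD; apply: measurable_funM.
move=> x m x0.
have := integrableD _ (integrableZl _ a (fi x m x0))
  (integrableZl _ b (gi x m x0)).
move=> /(_ _ _ _)/eq_integrable; apply => // t _ /=.
by rewrite -EFinD mulrDl !mulrA.
Qed.

Lemma continuous_primitive_log g : logL1 g ->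
  continuous (fun u => \int[mu]_(t in `]0, expR u]) g t).
Proof.
move=> Lg u; pose b := expR u + 1; pose g' := g \_ `]0, +oo[.
have b0 : 0 < b by rewrite addr_gt0// expR_gt0.
have ig' y : 0 < y -> mu.-integrable `[0, y] (EFin \o g').
  move=> y0; rewrite -restrict_EFin; apply/integrable_restrict => //.
  rewrite (_ : _ `&` _ = [set` `]0, y]]); first exact: logL1_integrable.
  apply/seteqP; split => t /=; rewrite !in_itv/=.
    by move=> [/andP[_ ->] /andP[->]].
  by move=> /andP[t0 ->]; rewrite t0 ltW.
(* The value of g at 0 is unconstrained; g' replaces it by 0. *)
have -> : (fun u => \int[mu]_(t in `]0, expR u]) g t) =
    (fun y => parameterized_integral mu 0 y g') \o expR.
  apply/funext => v /=.
  rewrite /parameterized_integral -Rintegral_itv_obnd_cbnd; last first.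
    by apply: integrableS (ig' _ (expR_gt0 v)) => // t; exact: subset_itv_oc_cc.
  apply: eq_Rintegral => t; rewrite inE => /subset_oc_ray tp.
  by rewrite /g' patchE mem_set.
apply: continuous_comp; first exact: continuous_expR.
apply: (within_continuous_continuous b0).
  exact: parameterized_integral_continuous (ltW b0) (ig' b b0).
by rewrite in_itv/= expR_gt0/= /b ltrDl.
Qed.

Lemma continuous_log_chart g u :
  {for u, continuous (g \o expR)} -> {for expR u, continuous g}.
Proof.
move=> cg.
have cl : {for expR u, continuous ((g \o expR) \o (@ln R))}.
  apply: continuous_comp; first by apply: continuous_ln; exact: expR_gt0.
  by rewrite expRK.
move: cl; rewrite /prop_for /continuous_at /= expRK => cl.
apply: cvg_trans cl; apply: near_eq_cvg.
have := lt_nbhsr (expR_gt0 u).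
by apply: filterS => x x0 /=; rewrite lnK.
Qed.

Lemma is_derive_primitive_log g u : logL1 g -> {for expR u, continuous g} ->
  is_derive u 1 (fun v => \int[mu]_(t in `]0, expR v]) g t) (g (expR u) * expR u).
Proof.
move=> Lg cg.
have F x : 0 < x -> {for x, continuous g} ->
    is_derive x 1 (fun x => \int[mu]_(t in `]0, x]) g t) (g x).
  move=> x0 cx; have [b xb] : exists b, x < b.
    by exists (x + 1); rewrite ltrDl.
  have ig := logL1_integrable Lg (lt_trans x0 xb).
  have [dF] := @continuous_FTC1 R g (BRight 0) x b xb ig x0 cx.
  rewrite derive1E => F'.
  exact: DeriveDef dF F'.
apply: (is_derive1_comp (f := fun x => \int[mu]_(t in `]0, x]) g t)).
exact: F (expR_gt0 u) cg.
Qed.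

Lemma measurable_cesaro g : logL1 g ->
  measurable_fun (`]0, +oo[ : set R)
    (fun x => x^-1 * \int[mu]_(t in `]0, x]) g t).
Proof.
move=> Lg; pose F v : R := \int[mu]_(t in `]0, expR v]) g t.
have mF : measurable_fun (`]0, +oo[ : set R) (fun x => expR (- ln x) * F (ln x)).
  apply: measurable_funM; last first.
    apply: (@measurableT_comp _ _ _ _ _ _ F).
      exact: continuous_measurable_fun (continuous_primitive_log Lg).
    exact: measurable_funS (@measurable_ln R).
  apply: measurableT_comp; first exact: measurable_expR.
  apply: measurableT_comp; first exact: oppr_measurable.
  exact: measurable_funS (@measurable_ln R).
apply: eq_measurable_fun mF => x; rewrite inE/= in_itv/= andbT => x0.
by rewrite /F expRN lnK.
Qed.

(** Follows from (|l| + K)^n <= 2^n (|l|^n + K^n). *)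
Lemma logL1_integrable_shift g (K : R) x n : logL1 g -> 0 <= K -> 0 < x ->
  mu.-integrable `]0, x] (EFin \o (fun t => g t * (`|ln t| + K) ^+ n)).
Proof.
move=> [mg ig] K0 x0.
have mln : measurable_fun `]0, x] (@ln R).
  exact: measurable_funS (@measurable_ln R).
have i1 : mu.-integrable `]0, x]
    (fun t => (2 ^+ n)%:E * `|(g t * ln t ^+ n)%:E|)%E.
  by apply: integrableZl => //; apply: integrable_abse; exact: ig.
have i2 : mu.-integrable `]0, x]
    (fun t => (2 ^+ n * K ^+ n)%:E * `|(g t * ln t ^+ 0)%:E|)%E.
  by apply: integrableZl => //; apply: integrable_abse; exact: ig.
apply: le_integrable (integrableD _ i1 i2) => //.
  apply/measurable_EFinP; apply: measurable_funM.
    exact: measurable_funS (@subset_oc_ray x) mg.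
  apply: measurable_funX; apply: measurable_funD => //.
  exact: measurableT_comp.
move=> t _ /=; rewrite lee_fin expr0 mulr1.
rewrite !normrM [leRHS]ger0_norm; last first.
  by rewrite addr_ge0// !mulr_ge0// ?exprn_ge0.
rewrite mulrCA [2 ^+ n * K ^+ n * _]mulrC -mulrDr ler_wpM2l//.
rewrite !normrX ger0_norm ?addr_ge0// -mulrDr.
have [lK|Kl] := leP `|ln t| K.
- apply: (@le_trans _ _ ((2 * K) ^+ n)).
    by rewrite lerXn2r ?nnegrE ?addr_ge0 ?mulr_ge0// mulr2n mulrDl mul1r lerD2r.
  by rewrite exprMn ler_wpM2l ?exprn_ge0// lerDr exprn_ge0.
- apply: (@le_trans _ _ ((2 * `|ln t|) ^+ n)).
    rewrite lerXn2r ?nnegrE ?addr_ge0 ?mulr_ge0//.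
    by rewrite mulr2n mulrDl mul1r lerD2l ltW.
  by rewrite exprMn ler_wpM2l ?exprn_ge0// lerDl exprn_ge0.
Qed.

Lemma integral_inv s x : 0 < s -> s <= x ->
  (\int[mu]_(t in `[s, x]) (t^-1)%:E = (ln x - ln s)%:E)%E.
Proof.
move=> s0; rewrite le_eqVlt => /predU1P[<-|sx].
  by rewrite set_itv1 integral_set1 subrr.
have cV y : s <= y -> {for y, continuous (fun t : R => t^-1)}.
  by move=> sy; apply: inv_continuous; rewrite gt_eqF// (lt_le_trans s0).
rewrite (@continuous_FTC2 _ _ (@ln R))//.
- apply: continuous_in_subspaceT => y; rewrite inE/= in_itv/= => /andP[sy _].
  exact: cV.
- split.
  + move=> y; rewrite in_itv/= => /andP[sy _].
    have /@ex_derive// := is_derive1_ln (lt_trans s0 sy).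
  + by apply: cvg_at_right_filter; apply: continuous_ln.
  + by apply: cvg_at_left_filter; apply: continuous_ln; exact: lt_trans sx.
- move=> y; rewrite in_itv/= => /andP[sy _].
  by rewrite derive1E; have [_] := is_derive1_ln (lt_trans s0 sy).
Qed.

(** Tonelli's theorem applied to the kernel
k(t, s) = |ln t|^m / t * |g s| on the triangle 0 < s <= t <= x. Integrating in s
first dominates |ln t|^m times the mean of g over ]0, t]; integrating in t first
gives at most |g s| (|ln s| + |ln x|)^(m+1), because |ln t| <= |ln s| + |ln x| on
[s, x] and the integral of 1/t over [s, x] is ln x - ln s. *)
Lemma logL1_cesaro g : logL1 g ->
  logL1 (fun x => x^-1 * \int[mu]_(t in `]0, x]) g t).
Proof.
move=> Lg; split; first exact: measurable_cesaro.
move=> x m x0; pose D : set R := [set` `]0, x]].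
have mD : measurable D by exact: measurable_itv.
have mln : measurable_fun setT (@ln R) := @measurable_ln R.
have mexp : measurable_fun setT (fun t : R => expR (- ln t)).
  apply: measurableT_comp; first exact: measurable_expR.
  exact: measurableT_comp.
(* e^(- ln t) is 1/t on D, and is measurable on the whole line. *)
pose w (t : R) : R := \1_D t * (`|ln t| ^+ m * expR (- ln t)).
pose G : R -> R := (fun s => `|g s|) \_ D.
pose A : set (R * R) := [set p | p.2 <= p.1].
pose k (p : R * R) : \bar R := (w p.1 * G p.2 * \1_A p)%:E.
have GD s : D s -> G s = `|g s| by move=> Ds; rewrite /G patchE mem_set.
have GN s : ~ D s -> G s = 0 by move=> Ds; rewrite /G patchE memNset.
have G0 s : 0 <= G s by have [/GD->|/GN->] := pselect (D s).
have mG : measurable_fun setT G.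
  apply/(measurable_restrictT _ _).1; first exact: measurable_itv.
  have mg : measurable_fun D g.
    by apply: measurable_funS Lg.1 => //; exact: subset_oc_ray.
  exact: measurableT_comp mg.
have w0 t : 0 <= w t by rewrite !mulr_ge0// ?exprn_ge0 ?expR_ge0.
have mw : measurable_fun setT w.
  apply: measurable_funM; first by apply: measurable_indic.
  apply: measurable_funM; first by apply: measurable_funX; exact: measurableT_comp.
  exact: mexp.
have mA : measurable A.
  rewrite -[A]setTI; apply: measurable_fun_le => //.
have mk : measurable_fun setT k.
  apply/measurable_EFinP; apply: measurable_funM; last by apply: measurable_indic.
  apply: measurable_funM; apply: measurableT_comp => //.
have k0 p : (0 <= k p)%E by rewrite lee_fin !mulr_ge0.
(* Integrating the kernel in s dominates the mean of g. *)
have inner1 t : D t ->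
    (`|(t^-1 * (\int[mu]_(s in `]0, t]) g s) * ln t ^+ m)%:E| <=
     \int[mu]_s k (t, s))%E.
  move=> Dt; move: (Dt); rewrite /D/= in_itv/= => /andP[t0 tx].
  have -> : (\int[mu]_s k (t, s) =
      (w t)%:E * \int[mu]_(s in `]0%R, t]) `|(g s)%:E|)%E.
    rewrite -ge0_integralZl ?lee_fin//; last first.
      apply: measurableT_comp => //; apply/measurable_EFinP.
      by apply: measurable_funS Lg.1 => //; exact: subset_oc_ray.
    rewrite [RHS]integral_mkcond; apply: eq_integral => s _.
    rewrite patchE /k /A/= indicE; case: ifPn.
      rewrite inE/= in_itv/= => /andP[s0 st].
      by rewrite mem_set// mulr1 EFinM GD// /D/= in_itv/= s0 (le_trans st).
    rewrite notin_setE/= in_itv/= => /negP; rewrite negb_and => /orP[s0|st].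
      by rewrite GN ?mulr0 ?mul0r// /D/= in_itv/= (negbTE s0).
    by rewrite memNset ?mulr0//=; exact/negP.
  have ig := logL1_integrable Lg t0.
  have -> : w t = `|t^-1| * `|ln t ^+ m|.
    rewrite /w indicE mem_set// mul1r expRN lnK// normrX mulrC.
    by rewrite [`|t^-1|]ger0_norm// invr_ge0 ltW.
  rewrite mulrAC !normrM EFinM lee_wpmul2l ?lee_fin//.
  rewrite EFin_normr_Rintegral//; apply: le_abse_integral => //.
  exact: measurable_int ig.
pose K : R := `|ln x|; have K0 : 0 <= K := normr_ge0 _.
(* Integrating the kernel in t adds one power of the logarithm. *)
have inner2 s : (\int[mu]_t k (t, s) <= (G s * (`|ln s| + K) ^+ m.+1)%:E)%E.
  have [Ds|Ds] := pselect (D s); last first.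
    rewrite GN// mul0r integral0_eq// => t _.
    by rewrite /k/= GN// mulr0 mul0r.
  move: (Ds); rewrite /D/= in_itv/= => /andP[s0 sx].
  pose c := G s * (`|ln s| + K) ^+ m.
  have c0 : 0 <= c by rewrite mulr_ge0// exprn_ge0// addr_ge0.
  have V0 t : [set` `[s, x]] t -> (0 <= (t^-1)%:E)%E.
    rewrite /= in_itv/= => /andP[st _].
    by rewrite lee_fin invr_ge0 (le_trans _ st)// ltW.
  have mV : measurable_fun [set` `[s, x]] (fun t : R => (t^-1)%:E).
    apply/measurable_EFinP.
    apply: (@eq_measurable_fun _ _ _ _ _ (fun t => expR (- ln t))).
      move=> t; rewrite inE/= in_itv/= => /andP[st _].
      by rewrite expRN lnK// posrE (lt_le_trans s0).
    exact: measurable_funS mexp.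
  apply: (@le_trans _ _ (c%:E * \int[mu]_(t in `[s, x]) (t^-1)%:E)%E).
    rewrite -ge0_integralZl ?lee_fin// [leRHS]integral_mkcond.
    apply: ge0_le_integral => //.
    - exact: (measurableT_comp mk (measurable_pair2 s)).
    - apply/(measurable_restrictT _ _).1 => //; exact: measurable_funeM.
    - move=> t _; rewrite patchE /k/=.
      have pV : t \in [set` `[s, x]] -> (0 <= (c * t^-1)%:E)%E.
        by rewrite inE => /V0; rewrite !lee_fin; exact: mulr_ge0.
      have [Dt|Dt] := pselect (D t); last first.
        by rewrite /w indicE memNset// !mul0r; case: ifP => // /pV.
      rewrite indicE /A; have [st|/negP st] := pselect (s <= t); last first.
        by rewrite memNset//= ?mulr0//; [case: ifP => // /pV|exact/negP].
      move: Dt; rewrite /D/= in_itv/= => /andP[t0 tx].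
      rewrite !mem_set//=; last by rewrite in_itv/= st tx.
      rewrite lee_fin mulr1 /w indicE mem_set ?mul1r; last first.
        by rewrite /D/= in_itv/= t0 tx.
      rewrite expRN lnK// mulrC mulrA ler_wpM2r ?invr_ge0 ?(ltW t0)//.
      rewrite ler_wpM2l// lerXn2r ?nnegrE ?addr_ge0//.
      have lst : ln s <= ln t by rewrite ler_ln.
      have ltx : ln t <= ln x by rewrite ler_ln.
      have := ler_norm (ln x); have := ler_norm (- ln s); rewrite normrN -/K.
      have := normr_ge0 (ln s).
      by rewrite ler_norml; lra.
  rewrite integral_inv// -EFinM lee_fin /c -mulrA ler_wpM2l// exprSr.
  rewrite ler_wpM2l ?exprn_ge0 ?addr_ge0//.
  by rewrite addrC lerD ?ler_norm// -normrN ler_norm.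
apply/integrableP; split.
  apply/measurable_EFinP; apply: measurable_funM.
    by apply: measurable_funS (measurable_cesaro Lg) => //; exact: subset_oc_ray.
  by apply: measurable_funX; exact: measurable_funS mln.
have mF : measurable_fun setT (fun t => \int[mu]_s k (t, s))%E.
  exact: (measurable_fun_fubini_tonelli_F (m2 := mu)).
apply: (@le_lt_trans _ _ (\int[mu]_t \int[mu]_s k (t, s))%E).
  rewrite integral_mkcond; apply: ge0_le_integral => //.
  - by move=> t _; rewrite patchE; case: ifP.
  - apply/(measurable_restrictT _ _).1 => //; apply: measurableT_comp => //.
    apply/measurable_EFinP; apply: measurable_funM; last first.
      by apply: measurable_funX; exact: measurable_funS mln.
    by apply: measurable_funS (measurable_cesaro Lg) => //; exact: subset_oc_ray.
  - move=> t _; rewrite patchE; case: ifPn => [|_]; last exact: integral_ge0.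
    by rewrite inE => /inner1.
rewrite fubini_tonelli//.
apply: (@le_lt_trans _ _ (\int[mu]_s (G s * (`|ln s| + K) ^+ m.+1)%:E)%E).
  apply: ge0_le_integral => //.
  - by move=> s _; exact: integral_ge0.
  - exact: (measurable_fun_fubini_tonelli_G (m1 := mu)).
  - apply/measurable_EFinP; apply: measurable_funM => //.
    apply: measurable_funX; apply: measurable_funD => //; exact: measurableT_comp.
have /integrableP[_] := logL1_integrable_shift (K := K) m.+1 Lg (normr_ge0 _) x0.
rewrite [X in (X < _)%E -> _]integral_mkcond => h; apply: le_lt_trans h.
rewrite le_eqVlt; apply/orP; left; apply/eqP.
apply: eq_integral => s _; rewrite patchE; case: ifPn.
  rewrite inE => Ds; rewrite GD//= normrM; congr (_ * _)%:E.
  by rewrite [RHS]ger0_norm// exprn_ge0// addr_ge0.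
by rewrite notin_setE => Ds; rewrite GN// mul0r.
Qed.

(** * Real and imaginary parts; stability and linearity of the operator *)

Lemma ReM (y z : R[i]) :
  complex.Re (y * z) = complex.Re y * complex.Re z - complex.Im y * complex.Im z.
Proof. by case: y z => [a b] [c d]. Qed.

Lemma ImM (y z : R[i]) :
  complex.Im (y * z) = complex.Re y * complex.Im z + complex.Im y * complex.Re z.
Proof. by case: y z => [a b] [c d]. Qed.

Lemma ReD (y z : R[i]) : complex.Re (y + z) = complex.Re y + complex.Re z.
Proof. by case: y z => [a b] [c d]. Qed.

Lemma ImD (y z : R[i]) : complex.Im (y + z) = complex.Im y + complex.Im z.
Proof. by case: y z => [a b] [c d]. Qed.

Lemma ReMr (z : R[i]) t : complex.Re (z * t%:C) = complex.Re z * t.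
Proof. by rewrite ReM/= mulr0 subr0. Qed.

Lemma ImMr (z : R[i]) t : complex.Im (z * t%:C) = complex.Im z * t.
Proof. by rewrite ImM/= mulr0 add0r. Qed.

Lemma normc_ge_Re (z : R[i]) : `|complex.Re z| <= Normc.normc z.
Proof.
by case: z => a b /=; rewrite -sqrtr_sqr ler_wsqrtr// lerDl sqr_ge0.
Qed.

Lemma normc_ge_Im (z : R[i]) : `|complex.Im z| <= Normc.normc z.
Proof.
by case: z => a b /=; rewrite -sqrtr_sqr ler_wsqrtr// lerDr sqr_ge0.
Qed.

Lemma normc_le_ReIm (z : R[i]) :
  Normc.normc z <= `|complex.Re z| + `|complex.Im z|.
Proof.
case: z => a b /=; rewrite -[leRHS]ger0_norm ?addr_ge0// -sqrtr_sqr ler_wsqrtr//.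
rewrite sqrrD !real_normK ?num_real// lerD2r lerDl.
by rewrite mulrn_wge0// mulr_ge0.
Qed.

Lemma normc_ge0 (z : R[i]) : 0 <= Normc.normc z.
Proof. exact: le_trans (normr_ge0 _) (normc_ge_Re z). Qed.

Lemma measurable_normc (D : set R) (h : R -> R[i]) :
  measurable_fun D (fun t => complex.Re (h t)) ->
  measurable_fun D (fun t => complex.Im (h t)) ->
  measurable_fun D (fun t => Normc.normc (h t)).
Proof.
move=> mRe mIm.
have -> : (fun t => Normc.normc (h t)) =
    (fun t => Num.sqrt (complex.Re (h t) ^+ 2 + complex.Im (h t) ^+ 2)).
  by apply/funext => t; case: (h t).
apply: (@measurableT_comp _ _ _ _ _ _ (@Num.sqrt R)).
  exact: continuous_measurable_fun (@sqrt_continuous R).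
by apply: measurable_funD; exact: measurable_funX.
Qed.

(** The two inequalities |Re z|, |Im z| <= |z| <= |Re z| + |Im z| transfer
integrability in both directions; a bound x < 1 is reduced to x = 1 by
monotonicity in the domain. *)
Lemma inF_logL1 (f : R -> R[i]) :
  inF f <->
  logL1 (fun t => complex.Re (f t)) /\ logL1 (fun t => complex.Im (f t)).
Proof.
have mlnX (x : R) n : measurable_fun [set` `]0, x]] (fun t : R => ln t ^+ n).
  by apply: measurable_funX; exact: measurable_funS (@measurable_ln R).
have mD (g : R -> R) x n : measurable_fun (`]0, +oo[ : set R) g ->
    measurable_fun [set` `]0, x]] (fun t => g t * ln t ^+ n).
  move=> mg; apply: measurable_funM => //.
  by apply: measurable_funS mg => //; exact: subset_oc_ray.
have mN (x : R) n :
    measurable_fun (`]0, +oo[ : set R) (fun t => complex.Re (f t)) ->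
    measurable_fun (`]0, +oo[ : set R) (fun t => complex.Im (f t)) ->
    measurable_fun [set` `]0, x]] (fun t => Normc.normc (f t * (ln t ^+ n)%:C)).
  move=> mRe mIm; apply: measurable_normc.
    rewrite (funext (fun t => ReMr (f t) (ln t ^+ n))); exact: mD.
  rewrite (funext (fun t => ImMr (f t) (ln t ^+ n))); exact: mD.
split=> [[mRe mIm fi]|[[mRe iRe] [mIm iIm]]].
- suff H (p : R[i] -> R) : (forall z t, p (z * t%:C) = p z * t) ->
      (forall z, `|p z| <= Normc.normc z) ->
      measurable_fun (`]0, +oo[ : set R) (fun t => p (f t)) ->
      logL1 (fun t => p (f t)).
    by split; apply: H => //;
      [exact: ReMr|exact: normc_ge_Re|exact: ImMr|exact: normc_ge_Im].
  move=> pM pn mp; split => // x m x0; pose y := Num.max x 1.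
  have y1 : 1 <= y by rewrite le_max lexx orbT.
  suff : mu.-integrable `]0, y] (EFin \o (fun t => p (f t) * ln t ^+ m)).
    apply: integrableS => //.
    by apply: subset_itvl; rewrite bnd_simp le_max lexx.
  apply/integrableP; split; first by apply/measurable_EFinP; exact: mD.
  apply: le_lt_trans (fi y m y1); apply: ge0_le_integral => //.
  + by apply: measurableT_comp => //; apply/measurable_EFinP; exact: mD.
  + by apply/measurable_EFinP; exact: mN.
  + by move=> t _; rewrite lee_fin -pM.
- split => // x m x1; have x0 : 0 < x by exact: lt_le_trans x1.
  have /integrableP[_] : mu.-integrable `]0, x]
      (fun t => `|(complex.Re (f t) * ln t ^+ m)%:E| +
                `|(complex.Im (f t) * ln t ^+ m)%:E|)%E.
    by apply: integrableD => //; apply: integrable_abse; [exact: iRe|exact: iIm].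
  apply: le_lt_trans; apply: ge0_le_integral => //.
  + by move=> t _; rewrite lee_fin normc_ge0.
  + by apply/measurable_EFinP; exact: mN.
  + apply: measurableT_comp => //; apply: emeasurable_funD;
      by apply: measurableT_comp => //; apply/measurable_EFinP; exact: mD.
  + move=> t _ /=; rewrite lee_fin [leRHS]ger0_norm ?addr_ge0//.
    by have := normc_le_ReIm (f t * (ln t ^+ m)%:C); rewrite ReMr ImMr.
Qed.

Lemma inF_ext (f g : R -> R[i]) : eq_pos f g -> inF f -> inF g.
Proof.
move=> fg /inF_logL1[LR LI]; apply/inF_logL1; split.
- by apply: logL1_ext LR => t t0; rewrite fg.
- by apply: logL1_ext LI => t t0; rewrite fg.
Qed.

Lemma inF_lin (f g : R -> R[i]) (a b : R[i]) : inF f -> inF g ->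
  inF (fun t => a * f t + b * g t).
Proof.
move=> /inF_logL1[fR fI] /inF_logL1[gR gI]; apply/inF_logL1; split.
- apply: logL1_ext (logL1_lin 1 1
    (logL1_lin (complex.Re a) (- complex.Im a) fR fI)
    (logL1_lin (complex.Re b) (- complex.Im b) gR gI)).
  by move=> t _; rewrite ReD !ReM; ring.
- apply: logL1_ext (logL1_lin 1 1
    (logL1_lin (complex.Re a) (complex.Im a) fI fR)
    (logL1_lin (complex.Re b) (complex.Im b) gI gR)).
  by move=> t _; rewrite ImD !ImM; ring.
Qed.

(* The unqualified name also denotes the theorem on means of sequences. *)
Local Notation cesaro := (@Defs.cesaro R).

Lemma cesaroE (f : R -> R[i]) x :
  cesaro f x = integralC `]0, x] f * (x^-1)%:C.
Proof. by rewrite /cesaro mulrC fmorphV. Qed.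

Lemma cesaro_ext (f g : R -> R[i]) : eq_pos f g -> cesaro f = cesaro g.
Proof.
move=> fg; apply/funext => x; rewrite /cesaro /integralC; congr (_ * (_ +i* _));
  by apply: eq_Rintegral => t; rewrite inE/= in_itv/= => /andP[t0 _]; rewrite fg.
Qed.

Lemma inF_cesaro (f : R -> R[i]) : inF f -> inF (cesaro f).
Proof.
move=> /inF_logL1[fR fI]; apply/inF_logL1; split.
- by apply: logL1_ext (logL1_cesaro fR) => t _; rewrite cesaroE ReMr mulrC.
- by apply: logL1_ext (logL1_cesaro fI) => t _; rewrite cesaroE ImMr mulrC.
Qed.

Lemma inF_cesaro_sub (f : R -> R[i]) lam : inF f -> inF (cesaro_sub lam f).
Proof.
move=> Ff; apply: inF_ext (inF_lin 1 (- lam) (inF_cesaro Ff) Ff) => t _.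
by rewrite /cesaro_sub mul1r mulNr.
Qed.

Lemma Rintegral_lin f g (a b : R) x : logL1 f -> logL1 g -> 0 < x ->
  \int[mu]_(t in `]0, x]) (a * f t + b * g t) =
  a * (\int[mu]_(t in `]0, x]) f t) + b * (\int[mu]_(t in `]0, x]) g t).
Proof.
move=> Lf Lg x0; have fi := logL1_integrable Lf x0.
have gi := logL1_integrable Lg x0.
have fa : mu.-integrable `]0, x] (fun t => a%:E * (f t)%:E)%E.
  exact: integrableZl fi.
have gb : mu.-integrable `]0, x] (fun t => b%:E * (g t)%:E)%E.
  exact: integrableZl gi.
by rewrite RintegralD// !RintegralZl.
Qed.

Lemma cesaro_lin (f g : R -> R[i]) (a b : R[i]) : inF f -> inF g ->
  eq_pos (cesaro (fun t => a * f t + b * g t))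
         (fun x => a * cesaro f x + b * cesaro g x).
Proof.
move=> /inF_logL1[fR fI] /inF_logL1[gR gI] x x0; rewrite !cesaroE !mulrA -mulrDl.
congr (_ * _); apply/eqP; rewrite eq_complex; apply/andP; split; apply/eqP.
- rewrite ReD !ReM /=.
  rewrite [LHS](_ : _ = \int[mu]_(t in `]0, x])
      (1 * (complex.Re a * complex.Re (f t) +
            (- complex.Im a) * complex.Im (f t)) +
       1 * (complex.Re b * complex.Re (g t) +
            (- complex.Im b) * complex.Im (g t)))).
    by rewrite !Rintegral_lin//; [ring|exact: logL1_lin..].
  by apply: eq_Rintegral => t _; rewrite ReD !ReM; ring.
- rewrite ImD !ImM /=.
  rewrite [LHS](_ : _ = \int[mu]_(t in `]0, x])
      (1 * (complex.Re a * complex.Im (f t) +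
            complex.Im a * complex.Re (f t)) +
       1 * (complex.Re b * complex.Im (g t) +
            complex.Im b * complex.Re (g t)))).
    by rewrite !Rintegral_lin//; [ring|exact: logL1_lin..].
  by apply: eq_Rintegral => t _; rewrite ImD !ImM; ring.
Qed.

Lemma cesaro_sub_ext lam (f g : R -> R[i]) : eq_pos f g ->
  eq_pos (cesaro_sub lam f) (cesaro_sub lam g).
Proof. by move=> fg x x0; rewrite /cesaro_sub (cesaro_ext fg) fg. Qed.

Lemma iter_cesaro_sub_ext lam (f g : R -> R[i]) k : eq_pos f g ->
  eq_pos (iter k (cesaro_sub lam) f) (iter k (cesaro_sub lam) g).
Proof. by move=> fg; elim: k => //= k IH; exact: cesaro_sub_ext. Qed.

Lemma cesaro_sub_lin lam (f g : R -> R[i]) (a b : R[i]) : inF f -> inF g ->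
  eq_pos (cesaro_sub lam (fun t => a * f t + b * g t))
         (fun x => a * cesaro_sub lam f x + b * cesaro_sub lam g x).
Proof.
move=> Ff Fg x x0; rewrite /cesaro_sub (cesaro_lin a b Ff Fg)//; ring.
Qed.

(** * Calculus in the variable u = ln x *)

(** Derivative of a complex-valued function of a real variable, taken
componentwise, so that everything reduces to the calculus of real functions. *)
Definition cderiv (phi : R -> R[i]) u (d : R[i]) : Prop :=
  is_derive u 1 (fun v => complex.Re (phi v)) (complex.Re d) /\
  is_derive u 1 (fun v => complex.Im (phi v)) (complex.Im d).

Definition ccont (phi : R -> R[i]) u : Prop :=
  {for u, continuous (fun v => complex.Re (phi v))} /\
  {for u, continuous (fun v => complex.Im (phi v))}.

Lemma cderiv_eqfun (phi psi : R -> R[i]) u d :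
  phi =1 psi -> cderiv phi u d -> cderiv psi u d.
Proof. by move=> /funext ->. Qed.

Lemma cderiv_ccont (phi : R -> R[i]) u d : cderiv phi u d -> ccont phi u.
Proof.
by move=> [dR dI]; split; apply: differentiable_continuous;
  apply/derivable1_diffP;
  [case: dR|case: dI].
Qed.

Lemma cderiv_cst (c : R[i]) u : cderiv (fun=> c) u 0.
Proof. by split; exact: is_derive_cst. Qed.

Lemma cderivD (phi psi : R -> R[i]) u a b : cderiv phi u a -> cderiv psi u b ->
  cderiv (fun v => phi v + psi v) u (a + b).
Proof.
move=> [aR aI] [bR bI]; split; rewrite ?(ReD, ImD).
- by rewrite (funext (fun v => ReD (phi v) (psi v))); exact: is_deriveD.
- by rewrite (funext (fun v => ImD (phi v) (psi v))); exact: is_deriveD.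
Qed.

Lemma cderivM (phi psi : R -> R[i]) u a b : cderiv phi u a -> cderiv psi u b ->
  cderiv (fun v => phi v * psi v) u (a * psi u + phi u * b).
Proof.
move=> [aR aI] [bR bI]; split.
- rewrite (funext (fun v => ReM (phi v) (psi v))).
  have := is_deriveB (is_deriveM aR bR) (is_deriveM aI bI).
  by move=> /is_derive_eq; apply; rewrite ReD !ReM /GRing.scale/=; ring.
- rewrite (funext (fun v => ImM (phi v) (psi v))).
  have := is_deriveD (is_deriveM aR bI) (is_deriveM aI bR).
  by move=> /is_derive_eq; apply; rewrite ImD !ImM /GRing.scale/=; ring.
Qed.

Lemma ccontM (phi psi : R -> R[i]) u : ccont phi u -> ccont psi u ->
  ccont (fun v => phi v * psi v) u.
Proof.
move=> [aR aI] [bR bI]; split.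
- rewrite (funext (fun v => ReM (phi v) (psi v))).
  by apply: continuousB; exact: continuousM.
- rewrite (funext (fun v => ImM (phi v) (psi v))).
  by apply: continuousD; exact: continuousM.
Qed.

Lemma cderiv_id u : cderiv (fun v => v%:C) u 1.
Proof. by split => /=; [exact: is_derive_id|exact: is_derive_cst]. Qed.

Lemma cderiv_horner (q : {poly R[i]}) u :
  cderiv (fun v => q.[v%:C]) u q^`().[u%:C].
Proof.
elim/poly_ind: q => [|q c IH].
  rewrite deriv0 horner0; apply: cderiv_eqfun (cderiv_cst 0 u) => v.
  by rewrite horner0.
have := cderivD (cderivM IH (cderiv_id u)) (cderiv_cst c u).
rewrite derivD derivM derivX derivC !mulr1 !addr0 hornerD hornerMX.
by apply: cderiv_eqfun => v; rewrite hornerMXaddC.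
Qed.

Lemma cderiv_eq0 (phi : R -> R[i]) : (forall u, cderiv phi u 0) ->
  forall u v, phi u = phi v.
Proof.
move=> d0 u v.
have hR := is_derive_0_is_cst u v (fun w => (d0 w).1).
have hI := is_derive_0_is_cst u v (fun w => (d0 w).2).
by case: (phi u) (phi v) hR hI => [a b] [c d] /= -> ->.
Qed.

Lemma expC0 : expC (0 : R[i]) = 1.
Proof. by rewrite /expC/= expR0 cos0 sin0 !mul1r. Qed.

Lemma expCD (y z : R[i]) : expC (y + z) = expC y * expC z.
Proof.
case: y z => [a b] [c d]; rewrite /expC /= expRD cosD sinD.
by apply/eqP; rewrite eq_complex /=; apply/andP; split; apply/eqP; ring.
Qed.

Lemma expC_real u : expC u%:C = (expR u)%:C :> R[i].
Proof. by rewrite /expC/= cos0 sin0 mulr1 mulr0. Qed.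

Lemma normc_expC (z : R[i]) : Normc.normc (expC z) = expR (complex.Re z).
Proof.
rewrite /expC /Normc.normc !exprMn -mulrDr cos2Dsin2 mulr1.
by rewrite sqrtr_sqr ger0_norm// expR_ge0.
Qed.

Lemma expC_neq0 (z : R[i]) : expC z != 0.
Proof.
apply/eqP => z0; have := normc_expC z; rewrite z0 Normc.normc0 => /eqP.
by rewrite lt_eqF// expR_gt0.
Qed.

Lemma cderiv_expC (z : R[i]) u :
  cderiv (fun v => expC (z * v%:C)) u (z * expC (z * u%:C)).
Proof.
have lin (a : R) : is_derive u 1 (fun v : R => a * v) a.
  have := is_deriveZ a (is_derive_id u 1).
  by move=> /is_derive_eq; apply; rewrite /GRing.scale/= mulr1.
have ex (a : R) : is_derive u 1 (fun v => expR (a * v)) (expR (a * u) * a).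
  exact: is_derive1_comp (is_derive_expR _) (lin a).
have cs (a : R) : is_derive u 1 (fun v => cos (a * v)) (- sin (a * u) * a).
  exact: is_derive1_comp (is_derive_cos _) (lin a).
have sn (a : R) : is_derive u 1 (fun v => sin (a * v)) (cos (a * u) * a).
  exact: is_derive1_comp (is_derive_sin _) (lin a).
have h : cderiv (fun v => (expR (complex.Re z * v) * cos (complex.Im z * v)) +i*
      (expR (complex.Re z * v) * sin (complex.Im z * v)))
      u (z * expC (z * u%:C)).
  split => /=.
  - have := is_deriveM (ex (complex.Re z)) (cs (complex.Im z)).
    move=> /is_derive_eq; apply.
    by rewrite /expC ReM ReMr ImMr /GRing.scale/=; ring.
  - have := is_deriveM (ex (complex.Re z)) (sn (complex.Im z)).
    move=> /is_derive_eq; apply.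
    by rewrite /expC ImM ReMr ImMr /GRing.scale/=; ring.
by apply: cderiv_eqfun h => v; rewrite /expC ReMr ImMr.
Qed.

(** Multiplying phi by e^(- z u) gives a function with zero derivative. *)
Lemma cderiv_linear_ode (phi : R -> R[i]) (z : R[i]) :
  (forall u, cderiv phi u (z * phi u)) ->
  exists c, forall u, phi u = c * expC (z * u%:C).
Proof.
move=> dphi; exists (phi 0) => u.
have d0 v : cderiv (fun w => phi w * expC (- z * w%:C)) v 0.
  have := cderivM (dphi v) (cderiv_expC (- z) v).
  rewrite (_ : _ + _ = 0)//; ring.
have := cderiv_eq0 d0 u 0; rewrite /= mulr0 expC0 mulr1 => <-.
by rewrite -mulrA -expCD mulNr addNr expC0 mulr1.
Qed.

Lemma cderiv_primitive (f : R -> R[i]) u : inF f -> ccont (f \o expR) u ->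
  cderiv (fun v => integralC `]0, expR v] f) u (f (expR u) * (expR u)%:C).
Proof.
move=> /inF_logL1[LR LI] [cR cI]; split; rewrite ?(ReMr, ImMr).
- by apply: is_derive_primitive_log LR _; exact: continuous_log_chart.
- by apply: is_derive_primitive_log LI _; exact: continuous_log_chart.
Qed.

(** * The functions x^rho q(ln x) *)

Lemma measurable_expR_ln (D : set R) (a : R) : measurable D ->
  measurable_fun D (fun t => expR (a * ln t)).
Proof.
move=> mD; apply: measurableT_comp; first exact: measurable_expR.
by apply: measurable_funM => //; exact: measurable_funS (@measurable_ln R).
Qed.

(** The power t^a is written e^(a ln t). The fundamental theorem of calculus
gives the bound on each [e^-n, x], and monotone convergence extends it to
]0, x]. *)
Lemma integral_pow_le (a x : R) : 0 < a + 1 -> 0 < x ->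
  (\int[mu]_(t in `]0%R, x]) (expR (a * ln t))%:E <=
   (expR ((a + 1) * ln x) / (a + 1))%:E)%E.
Proof.
move=> a1 x0; set B := (_ / _)%:E.
pose F n : set R := [set` `[expR (- n%:R), x]].
pose prim (t : R) : R := expR ((a + 1) * ln t) / (a + 1).
have dprim (t : R) : 0 < t -> is_derive t 1 prim (expR (a * ln t)).
  move=> t0.
  have l : is_derive t 1 (fun s => (a + 1) * ln s) ((a + 1) * t^-1).
    exact: (is_deriveZ (a + 1) (is_derive1_ln t0)).
  have e := @is_derive1_comp R expR (fun s => (a + 1) * ln s) _ _ _
    (is_derive_expR _) l.
  have := is_deriveZ (a + 1)^-1 e.
  rewrite (_ : (a + 1)^-1 \*: _ = prim); last first.
    by apply/funext => s; rewrite /prim mulrC.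
  move=> /is_derive_eq; apply; rewrite /GRing.scale/= mulrDl mul1r expRD lnK//.
  by field; rewrite !gt_eqF.
have leB n : (\int[mu]_(t in F n) (expR (a * ln t))%:E <= B)%E.
  rewrite /F; have e0 := expR_gt0 (- n%:R : R).
  have [ex|xe] := ltP (expR (- n%:R)) x; last first.
    rewrite (_ : \int[mu]_(t in _) _ = 0)%E.
      by rewrite lee_fin divr_ge0 ?expR_ge0 ?ltW.
    move: xe; rewrite le_eqVlt => /predU1P[->|xe].
      by rewrite set_itv1 integral_set1.
    by rewrite set_itv_ge ?integral_set0// bnd_simp -ltNge.
  rewrite (@continuous_FTC2 _ _ prim)//.
  - by rewrite /B -EFinB lee_fin lerBlDr lerDl divr_ge0 ?expR_ge0 ?ltW.
  - apply: continuous_in_subspaceT => y; rewrite inE/= in_itv/= => /andP[ey _].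
    have y0 : 0 < y by exact: lt_le_trans ey.
    apply: (@continuous_comp _ _ _ (fun t : R => a * ln t) expR).
      by apply: continuousM; [exact: cst_continuous|exact: continuous_ln].
    exact: continuous_expR.
  - have cprim y : 0 < y -> {for y, continuous prim}.
      move=> y0; apply: differentiable_continuous; apply/derivable1_diffP.
      by have [] := dprim y y0.
    split.
    + move=> y; rewrite in_itv/= => /andP[ey _].
      by have [] := dprim y (lt_trans e0 ey).
    + by apply: cvg_at_right_filter; exact: cprim.
    + by apply: cvg_at_left_filter; exact: cprim.
  - move=> y; rewrite in_itv/= => /andP[ey _].
    by rewrite derive1E; have [_] := dprim y (lt_trans e0 ey).
have -> : [set` `]0, x]] = \bigcup_n F n.
  apply/seteqP; split => t /=.
    rewrite in_itv/= => /andP[t0 tx].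
    exists (Num.truncn `|ln t|).+1 => //; rewrite /F/= in_itv/= tx andbT.
    rewrite -[leRHS]lnK ?posrE// ler_expR lerNl.
    apply: (@le_trans _ _ `|ln t|); first by rewrite -normrN ler_norm.
    exact/ltW/truncnS_gt.
  move=> [n _]; rewrite /F/= !in_itv/= => /andP[et ->].
  by rewrite (lt_le_trans (expR_gt0 _) et).
have cv : ((\int[mu]_(t in F i) (expR (a * ln t))%:E)%E @[i --> \oo] -->
    (\int[mu]_(t in \bigcup_i F i) (expR (a * ln t))%:E)%E).
  apply: ge0_nondecreasing_set_cvg_integral => //.
  - move=> n m nm; rewrite subsetEset; apply: subset_itvr.
    by rewrite bnd_simp ler_expR lerN2 ler_nat.
  - by move=> i; exact: measurable_itv.
  - move=> i; apply/measurable_EFinP; apply: measurable_expR_ln.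
    exact: measurable_itv.
by apply: cvge_to_le cv _; exact: nearW.
Qed.

Lemma integrable_pow (a x : R) : 0 < a + 1 -> 0 < x ->
  mu.-integrable `]0, x] (EFin \o (fun t => expR (a * ln t))).
Proof.
move=> a1 x0; apply/integrableP; split.
  by apply/measurable_EFinP; apply: measurable_expR_ln; exact: measurable_itv.
apply: (@le_lt_trans _ _ (expR ((a + 1) * ln x) / (a + 1))%:E); last exact: ltry.
apply: le_trans (integral_pow_le a1 x0).
rewrite le_eqVlt; apply/orP; left; apply/eqP; apply: eq_integral => t _ /=.
by rewrite ger0_norm// expR_ge0.
Qed.

Lemma Rintegral_pow_le (a x : R) : 0 < a + 1 -> 0 < x ->
  \int[mu]_(t in `]0, x]) expR (a * ln t) <= expR ((a + 1) * ln x) / (a + 1).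
Proof.
move=> a1 x0; rewrite -lee_fin (le_trans _ (integral_pow_le a1 x0))//.
rewrite /Rintegral fineK//.
by apply: integrable_fin_num => //; exact: integrable_pow.
Qed.

(** A polynomial grows slower than any exponential. The induction splits the
exponent in two halves, one of which absorbs the new factor u through
v <= e^v. *)
Lemma horner_expR_bound (q : {poly R[i]}) (d : R) : 0 < d ->
  exists2 C : R, 0 <= C & forall u, Normc.normc q.[u%:C] <= C * expR (d * `|u|).
Proof.
elim/poly_ind: q d => [|q c IH] d d0.
  by exists 0 => // u; rewrite horner0 Normc.normc0 mul0r.
have d2 : 0 < d / 2 by rewrite divr_gt0.
have [C C0 hC] := IH _ d2.
exists (C * (d / 2)^-1 + Normc.normc c) => [|u].
  by rewrite addr_ge0 ?normc_ge0// mulr_ge0// invr_ge0 ltW.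
rewrite hornerMXaddC; apply: le_trans (le_normcD _ _) _.
rewrite Normc.normcM mulrDl lerD//; last first.
  rewrite -[leLHS]mulr1 ler_wpM2l ?normc_ge0//.
  by rewrite -expR0 ler_expR mulr_ge0// ltW.
have -> : Normc.normc u%:C = `|u|.
  by rewrite /= expr0n addr0 sqrtr_sqr.
have -> : expR (d * `|u|) = expR (d / 2 * `|u|) * expR (d / 2 * `|u|).
  by rewrite -expRD -mulrDl -splitr.
have -> : C / (d / 2) * (expR (d / 2 * `|u|) * expR (d / 2 * `|u|)) =
  C * expR (d / 2 * `|u|) * ((d / 2)^-1 * expR (d / 2 * `|u|)) by ring.
apply: ler_pM => //; first exact: normc_ge0.
rewrite mulrC ler_pdivlMr// mulrC.
by apply: le_trans (expR_ge1Dx _); rewrite lerDr.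
Qed.

Definition powlog (rho : R[i]) (q : {poly R[i]}) : R -> R[i] :=
  fun x => cpow rho x * q.[(ln x)%:C].

Lemma powlog_expR rho q u :
  powlog rho q (expR u) = expC (rho * u%:C) * q.[u%:C].
Proof. by rewrite /powlog /cpow expRK. Qed.

Lemma powlogC (rho c : R[i]) x : powlog rho c%:P x = c * cpow rho x.
Proof. by rewrite /powlog hornerC mulrC. Qed.

Lemma powlog_lin (rho : R[i]) (a b : R[i]) (p q : {poly R[i]}) x :
  powlog rho (a *: p + b *: q) x = a * powlog rho p x + b * powlog rho q x.
Proof. by rewrite /powlog hornerD !hornerZ mulrDr !(mulrCA (cpow _ _)). Qed.

Lemma powlog_poly (rho : R[i]) (c : nat -> R[i]) n x :
  powlog rho (\poly_(j < n) c j) x = \sum_(j < n) c j * cpow_ln rho j x.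
Proof.
rewrite /powlog poly_def horner_sum mulr_sumr; apply: eq_bigr => j _.
by rewrite hornerZ hornerXn mulrCA /cpow_ln rmorphXn.
Qed.

(** One pair of integrable powers dominates x^rho q(ln x) for all q at once:
with s = Re rho and d = (s + 1) / 2, the polynomial costs a factor
e^(d |ln x|) <= x^d + x^(-d), and s - d is still larger than -1. *)
Lemma powlog_bound (rho : R[i]) : -1 < complex.Re rho ->
  exists a b : R, [/\ 0 < a + 1, 0 < b + 1 & forall q, exists2 C : R, 0 <= C &
    forall x, Normc.normc (powlog rho q x) <=
      C * (expR (a * ln x) + expR (b * ln x))].
Proof.
set s := complex.Re rho => s1; pose d := (s + 1) / 2.
have d0 : 0 < d by rewrite divr_gt0//; lra.
exists (s - d), (s + d); split; [by rewrite /d; lra|by rewrite /d; lra|move=> q].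
have [C C0 hC] := horner_expR_bound q d0.
exists C => // x; rewrite /powlog Normc.normcM /cpow normc_expC ReMr -/s.
apply: le_trans (ler_wpM2l (expR_ge0 _) (hC _)) _.
rewrite mulrCA ler_wpM2l// -expRD.
have [l0|l0] := leP 0 (ln x).
  by rewrite ger0_norm// -mulrDl lerDr expR_ge0.
by rewrite ltr0_norm// mulrN -mulrBl lerDl expR_ge0.
Qed.

Lemma ccont_powlog rho q u : ccont (powlog rho q \o expR) u.
Proof.
have := ccontM (cderiv_ccont (cderiv_expC rho u))
  (cderiv_ccont (cderiv_horner q u)).
rewrite (_ : (fun v => _ * _) = powlog rho q \o expR)//.
by apply/funext => v /=; rewrite powlog_expR.
Qed.

(** The weights (ln t)^m of the definition of F are absorbed in the polynomial,
so only the plain bound of [powlog_bound] is needed. *)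
Lemma inF_powlog rho q : -1 < complex.Re rho -> inF (powlog rho q).
Proof.
move=> s1; apply/inF_logL1.
suff H (p : R[i] -> R) : (forall z t, p (z * t%:C) = p z * t) ->
    (forall z, `|p z| <= Normc.normc z) ->
    continuous (fun u => p ((powlog rho q \o expR) u)) ->
    logL1 (fun t => p (powlog rho q t)).
  split; apply: H;
    [exact: ReMr|exact: normc_ge_Re| |exact: ImMr|exact: normc_ge_Im|].
  - by move=> u; exact: (ccont_powlog rho q u).1.
  - by move=> u; exact: (ccont_powlog rho q u).2.
move=> pM pn cp.
have mp : measurable_fun (`]0, +oo[ : set R)
    (fun t => p (powlog rho q t)).
  have := measurableT_comp (continuous_measurable_fun cp) (@measurable_ln R).
  move=> /(measurable_funS (measurableT : measurable (setT : set R))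
    (@subsetT _ (`]0, +oo[ : set R))).
  apply: eq_measurable_fun => t; rewrite inE/= in_itv/= andbT => t0.
  by rewrite lnK.
split => // x m x0.
have [a [b [a1 b1 /(_ (q * 'X^m))[C C0 hC]]]] := powlog_bound s1.
have ib : mu.-integrable `]0, x]
    (fun t => C%:E * ((expR (a * ln t))%:E + (expR (b * ln t))%:E))%E.
  apply: integrableZl => //; apply: integrableD => //; exact: integrable_pow.
apply: le_integrable ib => //.
  apply/measurable_EFinP; apply: measurable_funM.
    by apply: measurable_funS mp => //; exact: subset_oc_ray.
  by apply: measurable_funX; exact: measurable_funS (@measurable_ln R).
move=> t _ /=; rewrite lee_fin [leRHS]ger0_norm ?mulr_ge0 ?addr_ge0 ?expR_ge0//.
rewrite -pM (le_trans (pn _))//; apply: le_trans (hC t).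
by rewrite /powlog hornerM hornerXn mulrA rmorphXn.
Qed.

(** The right-hand side tends to 0 as u tends to -oo. The proof is explicit:
with g = min(al, be) and v = 2 M / (c g), the hypothesis at u = - v and
1 + g v <= e^(g v) give c + 2 M <= 2 M. *)
Lemma eq0_of_expR_bound (c M al be : R) : 0 < al -> 0 < be -> 0 <= c ->
  (forall u, c <= M * (expR (al * u) + expR (be * u))) -> c = 0.
Proof.
move=> al0 be0 c0 hc; apply/eqP/negPn/negP => cn0.
have {cn0}c0 : 0 < c by rewrite lt_neqAle eq_sym cn0.
have M0 : 0 < M.
  have := hc 0; rewrite !mulr0 expR0 => /(lt_le_trans c0).
  by rewrite pmulr_lgt0.
pose g := Num.min al be.
have g0 : 0 < g by rewrite lt_min al0 be0.
pose v := 2 * M / (c * g); have v0 : 0 <= v by rewrite divr_ge0 ?mulr_ge0 ?ltW.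
have le2 (e : R) : g <= e -> expR (e * - v) <= expR (- (g * v)).
  by move=> ge; rewrite ler_expR mulrN lerN2 ler_wpM2r.
have := hc (- v).
have h1 : expR (al * - v) + expR (be * - v) <= 2 * expR (- (g * v)).
  by rewrite mulrDl mul1r lerD// le2// ge_min lexx ?orbT.
move=> /le_trans /(_ (ler_wpM2l (ltW M0) h1)).
rewrite expRN mulrA ler_pdivlMr ?expR_gt0// => h2.
have := le_trans (ler_wpM2l (ltW c0) (expR_ge1Dx (g * v))) h2.
have -> : c * (1 + g * v) = c + M * 2 by rewrite /v; field; rewrite !gt_eqF.
by rewrite gerDr leNgt c0.
Qed.

Lemma normc_integralC_le (f : R -> R[i]) (a b C x : R) : inF f ->
  0 < a + 1 -> 0 < b + 1 -> 0 <= C -> 0 < x ->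
  (forall t, Normc.normc (f t) <= C * (expR (a * ln t) + expR (b * ln t))) ->
  Normc.normc (integralC `]0, x] f) <=
  2 * C * (expR ((a + 1) * ln x) / (a + 1) + expR ((b + 1) * ln x) / (b + 1)).
Proof.
move=> /inF_logL1[fR fI] a1 b1 C0 x0 hC.
have ia := integrable_pow a1 x0; have ib := integrable_pow b1 x0.
have iab : mu.-integrable `]0, x]
    (EFin \o (fun t => expR (a * ln t) + expR (b * ln t))).
  by have := integrableD _ ia ib; exact.
have iC : mu.-integrable `]0, x]
    (EFin \o (fun t => C * (expR (a * ln t) + expR (b * ln t)))).
  exact: integrableZl iab.
suff H (g : R -> R) : logL1 g -> (forall t, `|g t| <= Normc.normc (f t)) ->
    `|\int[mu]_(t in `]0, x]) g t| <=
    C * (expR ((a + 1) * ln x) / (a + 1) + expR ((b + 1) * ln x) / (b + 1)).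
  apply: le_trans (normc_le_ReIm _) _.
  rewrite -mulrA mulrDl !mul1r /=; apply: lerD; apply: H => // t.
    exact: normc_ge_Re.
  exact: normc_ge_Im.
move=> Lg gf; have ig := logL1_integrable Lg x0.
apply: le_trans (le_normr_Rintegral _ ig) _ => //.
apply: (@le_trans _ _
  (\int[mu]_(t in `]0, x]) (C * (expR (a * ln t) + expR (b * ln t))))).
  apply: le_Rintegral => //.
    exact: integrable_norm ig.
  by move=> t _; exact: le_trans (hC t).
rewrite RintegralZl// ler_wpM2l// RintegralD//.
by apply: lerD; exact: Rintegral_pow_le.
Qed.

(** In the variable u = ln x, the primitive Phi of powlog rho (mu p + p') and
gam(u) = e^(mu u) p(u) have the same derivative, so they differ by a constant;
both tend to 0 at -oo, with the rate given by [powlog_bound], so this constant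
is 0. *)
Lemma cesaro_powlog (rho : R[i]) (p : {poly R[i]}) : -1 < complex.Re rho ->
  eq_pos (cesaro (powlog rho ((rho + 1) *: p + p^`()))) (powlog rho p).
Proof.
move=> s1; set q := _ + _.
have [a [b [a1 b1 hab]]] := powlog_bound s1.
have [Cp Cp0 hp] := hab p; have [Cq Cq0 hq] := hab q.
have Fq := inF_powlog q s1.
pose Phi u := integralC `]0, expR u] (powlog rho q).
(* gam(ln x) is x times x^rho p(ln x), as e^u = x. *)
pose gam u := expC ((rho + 1) * u%:C) * p.[u%:C].
have expS (u : R) : expC (rho * u%:C) * (expR u)%:C = expC ((rho + 1) * u%:C).
  by rewrite -expC_real -expCD mulrDl mul1r.
have dPhi u : cderiv Phi u (expC ((rho + 1) * u%:C) * q.[u%:C]).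
  have := cderiv_primitive Fq (ccont_powlog rho q u).
  by rewrite powlog_expR mulrAC expS.
have dgam u : cderiv gam u (expC ((rho + 1) * u%:C) * q.[u%:C]).
  have := cderivM (cderiv_expC (rho + 1) u) (cderiv_horner p u).
  by rewrite /q hornerD hornerZ mulrDr mulrCA mulrA.
have d0 u : cderiv (fun v => Phi v + -1 * gam v) u 0.
  have := cderivD (dPhi u) (cderivM (cderiv_cst (-1) u) (dgam u)).
  by rewrite mul0r add0r mulN1r subrr.
have cst u : Phi 0 + -1 * gam 0 = Phi u + -1 * gam u by exact: (cderiv_eq0 d0).
have gamE u : gam u = powlog rho p (expR u) * (expR u)%:C.
  by rewrite powlog_expR mulrAC expS.
have c0 : Normc.normc (Phi 0 + -1 * gam 0) = 0.
  pose M := 2 * Cq * ((a + 1)^-1 + (b + 1)^-1) + Cp.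
  apply: (@eq0_of_expR_bound _ M (a + 1) (b + 1)) => //; first exact: normc_ge0.
  move=> u; rewrite (cst u); apply: le_trans (le_normcD _ _) _.
  rewrite /M mulrDl; apply: lerD.
    apply: le_trans (normc_integralC_le Fq a1 b1 Cq0 (expR_gt0 u) hq) _.
    rewrite expRK -!mulrA ler_wpM2l// ler_wpM2l//.
    rewrite -subr_ge0.
    have -> : forall e f a' b' : R, (a' + b') * (e + f) - (e * a' + f * b') =
      a' * f + b' * e by move=> e f a' b'; ring.
    by rewrite addr_ge0// mulr_ge0 ?expR_ge0// invr_ge0 ltW.
  rewrite Normc.normcM normcN Normc.normc1 mul1r gamE Normc.normcM.
  have -> : Normc.normc (expR u)%:C = expR u.
    by rewrite /= expr0n addr0 sqrtr_sqr ger0_norm ?expR_ge0.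
  apply: le_trans (ler_wpM2r (expR_ge0 _) (hp _)) _.
  by rewrite -mulrA expRK mulrDl -!expRD !mulrDl !mul1r.
move=> x x0; rewrite cesaroE.
have : Phi (ln x) = gam (ln x).
  apply/eqP; rewrite -subr_eq0 -mulN1r -(cst (ln x)).
  by apply/eqP; exact: Normc.eq0_normc.
rewrite /Phi gamE lnK// => ->.
by rewrite -mulrA -rmorphM mulfV ?mulr1// gt_eqF.
Qed.

Lemma addr1_neq0 (rho : R[i]) : -1 < complex.Re rho -> rho + 1 != 0.
Proof.
move=> s1; apply/eqP => /(congr1 (@complex.Re R)); rewrite ReD /= => h.
by move: s1; rewrite -subr_gt0 opprK h ltxx.
Qed.

Lemma cesaro_sub_powlog (rho : R[i]) (p : {poly R[i]}) : -1 < complex.Re rho ->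
  eq_pos (cesaro_sub (rho + 1)^-1 (powlog rho ((rho + 1) *: p + p^`())))
         (powlog rho (- (rho + 1)^-1 *: p^`())).
Proof.
move=> s1 x x0; rewrite /cesaro_sub cesaro_powlog//.
rewrite /powlog hornerD !hornerZ; field; exact: addr1_neq0.
Qed.

Lemma cesaro_sub_powlog_size (rho : R[i]) (q : {poly R[i]}) : -1 < complex.Re rho ->
  exists2 q' : {poly R[i]}, size q' = (size q).-1 &
    eq_pos (cesaro_sub (rho + 1)^-1 (powlog rho q)) (powlog rho q').
Proof.
move=> s1; have mu0 := addr1_neq0 s1.
have [p <- _] := shift_deriv_surj q mu0.
exists (- (rho + 1)^-1 *: p^`()); last exact: cesaro_sub_powlog.
by rewrite size_scale ?oppr_eq0 ?invr_eq0// size_deriv_num size_shift_deriv.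
Qed.

Lemma iter_cesaro_sub_powlog (rho : R[i]) (q : {poly R[i]}) k :
  -1 < complex.Re rho ->
  exists2 q' : {poly R[i]}, size q' = (size q - k)%N &
    eq_pos (iter k (cesaro_sub (rho + 1)^-1) (powlog rho q)) (powlog rho q').
Proof.
move=> s1; elim: k => [|k [q' sq' IH]]; first by exists q => //; rewrite subn0.
have [q2 sq2 e2] := cesaro_sub_powlog_size q' s1.
exists q2; first by rewrite sq2 sq' subnS.
by move=> x x0; rewrite iterS (cesaro_sub_ext _ IH)// e2.
Qed.

Lemma powlog_size1_neq0 (rho : R[i]) (q : {poly R[i]}) : size q = 1%N ->
  ~ eq_pos (powlog rho q) (@zero_fun R).
Proof.
move=> /eqP/size_poly1P[c c0 ->] /(_ 1 ltr01) /eqP; apply/negP.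
by rewrite powlogC /cpow mulf_neq0// expC_neq0.
Qed.

(** * Eigenfunctions and generalised eigenfunctions *)

(** The eigenvalue equation says that f is (rho + 1) / x times its primitive.
As the primitive is continuous, f is continuous, so the primitive is
differentiable and solves a linear differential equation in u = ln x. *)
Lemma eigenspace_cpow (rho : R[i]) (f : R -> R[i]) : -1 < complex.Re rho ->
  inF f -> eq_pos (cesaro f) (fun x => (rho + 1)^-1 * f x) ->
  exists c : R[i], eq_pos f (fun x => c * cpow rho x).
Proof.
move=> s1 Ff ef; have mu0 := addr1_neq0 s1.
pose Phi u := integralC `]0, expR u] f.
have fE u : f (expR u) = (rho + 1) * (Phi u * expC (-1 * u%:C)).
  have := ef _ (expR_gt0 u); rewrite cesaroE -expRN => h.
  have -> : expC (-1 * u%:C) = (expR (- u))%:C.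
    by rewrite -expC_real rmorphN mulN1r.
  by rewrite h mulrA mulfV// mul1r.
have cPhi u : ccont Phi u.
  have [fR fI] := (inF_logL1 f).1 Ff.
  by split; [exact: continuous_primitive_log fR u|
             exact: continuous_primitive_log fI u].
have cf u : ccont (f \o expR) u.
  have -> : f \o expR = fun v => (rho + 1) * (Phi v * expC (-1 * v%:C)).
    by apply/funext => v; exact: fE.
  apply: ccontM; first exact: cderiv_ccont (cderiv_cst _ _).
  by apply: ccontM => //; exact: cderiv_ccont (cderiv_expC _ _).
have expN (u : R) : expC (-1 * u%:C) * (expR u)%:C = 1 :> R[i].
  by rewrite -expC_real -expCD mulN1r addNr expC0.
have dPhi u : cderiv Phi u ((rho + 1) * Phi u).
  have := cderiv_primitive Ff (cf u).
  by rewrite fE -!mulrA expN mulr1.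
have [c Phic] := cderiv_linear_ode dPhi.
exists ((rho + 1) * c) => x x0; rewrite -[x]lnK// fE Phic /cpow expRK.
by rewrite -!mulrA -expCD; congr (_ * (_ * expC _)); rewrite mulrDl; ring.
Qed.

(** The preimage r of q under P - 1/mu comes from [cesaro_sub_powlog]: any s with
- s' / mu = q gives r = mu s + s'. *)
Lemma powlog_of_iter_eq0 (rho : R[i]) m (f : R -> R[i]) : -1 < complex.Re rho ->
  inF f -> eq_pos (iter m.+1 (cesaro_sub (rho + 1)^-1) f) (@zero_fun R) ->
  exists2 q : {poly R[i]}, (size q <= m.+1)%N & eq_pos f (powlog rho q).
Proof.
move=> s1; have mu0 := addr1_neq0 s1.
have base (g : R -> R[i]) : inF g ->
    eq_pos (cesaro_sub (rho + 1)^-1 g) (@zero_fun R) ->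
    exists c, eq_pos g (powlog rho c%:P).
  move=> Fg g0; have [|c gc] := eigenspace_cpow s1 Fg.
    by move=> x x0; apply/eqP; rewrite -subr_eq0; apply/eqP; exact: g0.
  by exists c => x x0; rewrite powlogC gc.
elim: m f => [|m IH] f Ff.
  by move=> /(base _ Ff)[c fc]; exists c%:P => //; exact: size_polyC_leq1.
rewrite iterSr => /(IH _ (inF_cesaro_sub _ Ff))[q sq Tf].
have [s ds ss] := poly_antideriv (- (rho + 1) *: q).
pose r := (rho + 1) *: s + s^`().
have sr : (size r <= m.+2)%N.
  rewrite size_shift_deriv// (leq_trans ss)// ltnS.
  exact: leq_trans (size_scale_leq _ _) sq.
have [||c fc] := base (fun t => 1 * f t + -1 * powlog rho r t).
- exact: inF_lin Ff (inF_powlog r s1).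
- move=> x x0; rewrite cesaro_sub_lin//; last exact: inF_powlog.
  rewrite Tf// cesaro_sub_powlog// ds scalerA mulrNN mulVf// scale1r.
  by rewrite mul1r mulN1r subrr.
exists (c%:P + r).
  rewrite (leq_trans (size_polyD _ _))// geq_max sr andbT.
  by rewrite (leq_trans (size_polyC_leq1 _)).
move=> x x0; have := powlog_lin rho 1 1 c%:P r x.
by rewrite !scale1r !mul1r => ->; rewrite -fc// mul1r mulN1r subrK.
Qed.

Lemma gen_eigenfunction_powlogP (rho : R[i]) m (f : R -> R[i]) :
  -1 < complex.Re rho ->
  gen_eigenfunction m (rho + 1)^-1 f <->
  exists2 q : {poly R[i]}, size q = m.+1 & eq_pos f (powlog rho q).
Proof.
move=> s1; split=> [[Ff f0 fn0]|[q sq fq]].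
- have [q sq fq] := powlog_of_iter_eq0 s1 Ff f0; exists q => //.
  apply/eqP; rewrite eqn_leq sq ltnNge; apply/negP => qm.
  have [q' sq' e] := iter_cesaro_sub_powlog q m s1.
  apply: fn0 => x x0; rewrite (iter_cesaro_sub_ext _ _ fq)// e//.
  have /eqP : size q' = 0%N by rewrite sq'; apply/eqP; rewrite subn_eq0.
  by rewrite size_poly_eq0 => /eqP ->; rewrite /powlog horner0 mulr0.
- split.
  + by apply: inF_ext (inF_powlog q s1) => x x0; rewrite fq.
  + have [q' sq' e] := iter_cesaro_sub_powlog q m.+1 s1.
    move=> x x0; rewrite (iter_cesaro_sub_ext _ _ fq)// e//.
    move: sq'; rewrite sq subnn => /eqP.
    by rewrite size_poly_eq0 => /eqP ->; rewrite /powlog horner0 mulr0.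
  + have [q' sq' e] := iter_cesaro_sub_powlog q m s1 => h.
    apply: (@powlog_size1_neq0 rho q'); first by rewrite sq' sq subSnn.
    by move=> x x0; rewrite -e// -(iter_cesaro_sub_ext _ _ fq)// h.
Qed.

End CesaroEigenfunctions.

Theorem theorem1 (R : realType) (rho : R[i]) (hrho : -1 < complex.Re rho) :
  (* (i) *)
  (eigenfunction (rho + 1)^-1 (cpow rho) /\
   (forall f : R -> R[i],
      in_eigenspace (rho + 1)^-1 f <->
      exists c : R[i], eq_pos f (fun x => c * cpow rho x))) /\
  (* (ii) *)
  (forall m : nat, (1 <= m)%N ->
     gen_eigenfunction m (rho + 1)^-1 (cpow_ln rho m) /\
     (forall f : R -> R[i],
        gen_eigenfunction m (rho + 1)^-1 f <->
        exists c : nat -> R[i],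
          c m <> 0 /\
          eq_pos f (fun x => \sum_(j < m.+1) c j * cpow_ln rho j x))).
Proof.
have eigP (f : R -> R[i]) : in_eigenspace (rho + 1)^-1 f <->
    exists c : R[i], eq_pos f (fun x => c * cpow rho x).
  split=> [[Ff ef]|[c fc]]; first exact: eigenspace_cpow.
  have fE : eq_pos f (powlog rho c%:P) by move=> x x0; rewrite fc// powlogC.
  split; first by apply: inF_ext (inF_powlog c%:P hrho) => x x0; rewrite fE.
  have [q sq e] := cesaro_sub_powlog_size c%:P hrho.
  have {sq}q0 : q = 0.
    apply/eqP; rewrite -size_poly_eq0 sq size_polyC.
    by case: (c != 0).
  move=> x x0; apply/eqP; rewrite -subr_eq0 -/(cesaro_sub _ f x).
  by rewrite (cesaro_sub_ext _ fE)// e// q0 /powlog horner0 mulr0.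
split.
  split=> //; split.
    by apply/eigP; exists 1 => x _; rewrite mul1r.
  by move=> /(_ 1 ltr01)/eqP; apply/negP; exact: expC_neq0.
move=> m _; split.
  apply/gen_eigenfunction_powlogP => //; exists 'X^m; first exact: size_polyXn.
  by move=> x _; rewrite /powlog hornerXn /cpow_ln rmorphXn.
move=> f; split=> [/(gen_eigenfunction_powlogP _ _ hrho)[q sq fq]|[c [cm fc]]].
  exists (fun j => q`_j); split.
    apply/eqP; rewrite -[m]/(m.+1.-1) -sq -lead_coefE lead_coef_eq0.
    by rewrite -size_poly_eq0 sq.
  by move=> x x0; rewrite -powlog_poly -sq coefK fq.
apply/gen_eigenfunction_powlogP => //; exists (\poly_(j < m.+1) c j).
  by rewrite size_poly_eq//; apply/eqP.
by move=> x x0; rewrite powlog_poly fc.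
Qed.
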